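(* Let $F$ be a subfield of $\mathbb{R}$ and consider an elliptic curve over $F$ given by the equation $y^2+axy+by=x^3+cx^2+dx+e$ with $a,b,c,d,e\in F$. Suppose that there is a simultaneous arithmetic progression of length $k$ on this curve, i.e. a simultaneous arithmetic progression consisting of $k$ distinct points with coordinates in $F$, all of which satisfy the equation of the curve. Then $k\le 4319$.
   Context: A simultaneous arithmetic progression (s.a.p.) of length $k$ consists of $k$ distinct points $(x_i, y_{\sigma(i)})$, $i=0,1,\dots,k-1$, where $x_i=a_1+id_1$ and $y_i=a_2+id_2$ for $i=0,1,\dots,k-1$ are arithmetic progressions and $\sigma$ is a permutation of $\{0,1,\dots,k-1\}$. Elliptic curves are nonsingular, and the points considered are affine points. *)

(* Defs.v *)
From HB Require Import structures.
From mathcomp Require Import all_boot all_order all_algebra all_fingroup.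
From mathcomp Require Import reals complex mpoly.

Set Implicit Arguments.
Unset Strict Implicit.
Unset Printing Implicit Defensive.

Import Order.TTheory GRing.Theory Num.Theory.
Local Open Scope ring_scope.

(* The homogenization Y^2 Z + a XYZ + b Y Z^2 - (X^3 + c X^2 Z + d X Z^2 + e Z^3)
   of the affine equation, with variables numbered X = 0, Y = 1, Z = 2. *)
Definition weierstrass (K : comNzRingType) (a b c d e : K) : {mpoly K[3]} :=
  let X : {mpoly K[3]} := 'X_(inord 0) in
  let Y : {mpoly K[3]} := 'X_(inord 1) in
  let Z : {mpoly K[3]} := 'X_(inord 2) in
  Y ^+ 2 * Z + a *: (X * Y * Z) + b *: (Y * Z ^+ 2)
  - (X ^+ 3 + c *: (X ^+ 2 * Z) + d *: (X * Z ^+ 2) + e *: Z ^+ 3).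

(* Intended for homogeneous p over an algebraically closed K: the projective
   zero locus of p has no singular point. *)
Definition nonsingular (K : fieldType) (n : nat) (p : {mpoly K[n]}) : Prop :=
  forall v : 'I_n -> K,
    (exists i, v i != 0) -> p.@[v] = 0 -> exists i, p^`M(i).@[v] != 0.

(* Smoothness is geometric: it is tested at the points with coordinates in the
   algebraically closed field R[i]. *)
Definition elliptic (R : realType) (a b c d e : R) : Prop :=
  nonsingular (weierstrass a%:C b%:C c%:C d%:C e%:C)%C.

Definition on_curve (R : comNzRingType) (a b c d e : R) (p : R * R) : Prop :=
  let: (x, y) := p in
  y ^+ 2 + a * x * y + b * y = x ^+ 3 + c * x ^+ 2 + d * x + e.

(* Only the points are required to be distinct: either common difference may
   vanish. *)
Definition is_sap (R : zmodType) (k : nat) (P : 'I_k -> R * R) : Prop :=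
  injective P /\
  exists (a1 d1 a2 d2 : R) (s : {perm 'I_k}),
    forall i, P i = (a1 + d1 *+ i, a2 + d2 *+ s i).

(* Main.v *)
(* Rescale the grid so that the points become (i, s i) with 0 <= i, s i < k, on
   a curve y^2 + (b1 x + b0) y = cubic(x). The sign of 2y + b1 x + b0 splits the
   points into two branches, each a graph over the x-axis; join every point to
   the next one on its branch, which gives at least k - 2 edges. At most 2 edges
   lie above a given abscissa, and by the intermediate value theorem at most 8
   cross a given horizontal line, so few edges are wider than 5 or taller than
   23. A short edge has one of 5 * 47 difference vectors, and each vector occurs
   at most 4 times, since the curve meets its translate in at most 4 points. *)
Require Import Defs.
From mathcomp Require Import all_boot all_order all_algebra all_fingroup.
From mathcomp Require Import reals complex mpoly.
From mathcomp Require Import polyrcf zify ring lra.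

Set Implicit Arguments.
Unset Strict Implicit.
Unset Printing Implicit Defensive.

Import Order.TTheory GRing.Theory Num.Theory.
Local Open Scope ring_scope.

(** * Edges joining neighbouring points of a branch *)

(** These are the edges, when [u i] tells which branch carries the point of abscissa [i]. *)
Definition consecutive (k : nat) (u : 'I_k -> bool) : {set 'I_k * 'I_k} :=
  [set e : 'I_k * 'I_k | [&& (e.1 < e.2)%N, u e.1 == u e.2 &
    [forall l : 'I_k, (e.1 < l)%N && (l < e.2)%N ==> (u l != u e.1)]]].

Lemma consecutiveP (k : nat) (u : 'I_k -> bool) (e : 'I_k * 'I_k) :
  reflect [/\ (e.1 < e.2)%N, u e.1 = u e.2 &
    forall l : 'I_k, (e.1 < l)%N -> (l < e.2)%N -> u l != u e.1]
    (e \in consecutive u).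
Proof.
rewrite inE; apply: (iffP and3P) => [[lt_e /eqP eq_u /forallP Hl]|[lt_e eq_u Hl]].
  by split=> // l l1 l2; have := Hl l; rewrite l1 l2.
split=> //; first exact/eqP.
by apply/forallP=> l; apply/implyP=> /andP[l1 l2]; apply: Hl.
Qed.

(** If the left ends differed, the larger one would lie strictly inside the other edge and have its
    colour; the same goes for the smaller right end. *)
Lemma consecutive_overlap (k : nat) (u : 'I_k -> bool) (e f : 'I_k * 'I_k) :
  e \in consecutive u -> f \in consecutive u -> u e.1 = u f.1 ->
  (e.1 < f.2)%N -> (f.1 < e.2)%N -> e = f.
Proof.
case: e f => [i j] [i' j'] /consecutiveP[/= lij uij nij].
move=> /consecutiveP[/= lij' uij' nij'] uii li lj.
have eqi : i = i'.
  apply: val_inj => /=; case: (ltngtP i i') => // lt_i.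
  - by have := nij i' lt_i lj; rewrite uii eqxx.
  - by have := nij' i lt_i li; rewrite uii eqxx.
subst i'; congr pair; apply: val_inj => /=.
case: (ltngtP j j') => // lt_j.
- by have := nij' j lij lt_j; rewrite uij eqxx.
- by have := nij j' lij' lt_j; rewrite uij' eqxx.
Qed.

(** Every index starts an edge unless it is the last of its colour, and there are two colours. *)
Lemma card_consecutive (k : nat) (u : 'I_k -> bool) :
  (k <= #|consecutive u| + 2)%N.
Proof.
pose last b := [set i : 'I_k | (u i == b) && [forall j : 'I_k, (i < j)%N ==> (u j != b)]].
have last1 b : (#|last b| <= 1)%N.
  apply/card_le1_eqP => i j; rewrite !inE => /andP[/eqP ui /forallP Hi].
  move=> /andP[/eqP uj /forallP Hj]; apply: val_inj => /=.
  case: (ltngtP i j) => // lt_ij.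
  - by have := Hi j; rewrite lt_ij uj eqxx.
  - by have := Hj i; rewrite lt_ij ui eqxx.
have cover : [set: 'I_k] \subset
    [set e.1 | e in consecutive u] :|: (last true :|: last false).
  apply/subsetP => i _; rewrite in_setU; apply/orP.
  have [/existsP[j0 Pj0]|noj] :=
    boolP [exists j : 'I_k, (i < j)%N && (u j == u i)]; last first.
    right; have : i \in last (u i).
      rewrite inE eqxx; apply/forallP => j; apply/implyP=> ij.
      by apply: contra noj => uj; apply/existsP; exists j; rewrite ij.
    by rewrite in_setU; case: (u i) => ->; rewrite ?orbT.
  left.
  pose Q := fun j : 'I_k => (i < j)%N && (u j == u i).
  have := @arg_minnP _ j0 Q (fun j => val j) Pj0.
  case=> j /andP[ij /eqP uj] jmin; apply/imsetP; exists (i, j) => //.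
  apply/consecutiveP; split=> //= l il lj; apply/negP => ul.
  by have := jmin l; rewrite /Q il ul /= => /(_ isT); lia.
have := subset_leq_card cover; rewrite cardsT card_ord.
move=> /leq_trans; apply.
apply: leq_trans (leq_card_setU _ _) _; apply: leq_add; first exact: leq_imset_card.
apply: leq_trans (leq_card_setU _ _) _.
exact: (leq_add (last1 true) (last1 false)).
Qed.

Lemma double_count (T : finType) (E : {set T}) (k N C : nat)
    (cr : T -> 'I_k -> bool) :
  (forall e, e \in E -> (N <= #|[set m | cr e m]|)%N) ->
  (forall m, (#|[set e in E | cr e m]| <= C)%N) ->
  (#|E| * N <= k * C)%N.
Proof.
move=> hN hC; rewrite -sum_nat_const.
apply: leq_trans (leq_sum (index_enum T) hN) _.
under eq_bigr do rewrite -sum1dep_card big_mkcond.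
rewrite exchange_big /= -[k in (_ <= k * _)%N]card_ord -sum_nat_const.
apply: leq_sum => m _; apply: leq_trans (hC m).
rewrite -sum1dep_card big_mkcondr /=.
by [].
Qed.

Lemma card_ord_interval (k a b : nat) : (b <= k)%N ->
  #|[set m : 'I_k | (a <= m)%N && (m < b)%N]| = (b - a)%N.
Proof.
(* With [minn b k] for [b] the equality no longer needs [b <= k], so induction on [k] applies. *)
move=> bk; rewrite -[in RHS](minn_idPl bk) {bk} -sum1dep_card big_mkcond /=.
elim: k => [|k IHk]; first by rewrite big_ord0 minn0.
rewrite big_ord_recr /= IHk; case: ifP; lia.
Qed.

Lemma card_colour (k : nat) (u : 'I_k -> bool) (S : {set 'I_k * 'I_k}) (C : nat) :
  (forall b, #|[set e in S | u e.1 == b]| <= C)%N -> (#|S| <= C * 2)%N.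
Proof.
move=> hC; rewrite muln2 -addnn.
apply: leq_trans (leq_add (hC true) (hC false)).
apply: leq_trans (leq_card_setU _ _).
by apply/subset_leq_card/subsetP => e eS; rewrite !inE eS; case: (u _).
Qed.

(** An edge covers as many columns [m] as it is wide, and edges of one colour cover disjoint sets of
    columns. *)
Lemma card_long_columns (k : nat) (u : 'I_k -> bool) (A : nat) :
  (#|[set e in consecutive u | (A <= e.2 - e.1)%N]| * A <= k * 2)%N.
Proof.
apply: (double_count (cr := fun (e : 'I_k * 'I_k) (m : 'I_k) => (e.1 <= m)%N && (m < e.2)%N)).
  move=> e; rewrite inE => /andP[_]; rewrite card_ord_interval //.
  exact/ltnW.
move=> m; apply: (@card_colour _ u _ 1) => b; apply/card_le1_eqP => e f.
rewrite !inE -!andbA => /and5P[e1 e2 e3 e4 /and3P[e5 e6 /eqP e7]].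
move=> /and5P[f1 f2 f3 f4 /and3P[f5 f6 /eqP f7]].
apply: (@consecutive_overlap _ u); rewrite ?inE ?e1 ?e2 ?e3 ?f1 ?f2 ?f3 ?e7 //; lia.
Qed.

(** * Intersections of the cubic with its translates *)

Lemma card_lt_size_poly (R : idomainType) (T : finType) (A : {set T})
    (f : T -> R) (p : {poly R}) :
  p != 0 -> {in A &, injective f} -> {in A, forall x, root p (f x)} ->
  (#|A| < size p)%N.
Proof.
move=> p0 injf rootf; rewrite cardE -(size_map f); apply: max_poly_roots => //.
  by apply/allP => _ /mapP[x xA ->]; apply: rootf; rewrite -mem_enum.
rewrite map_inj_in_uniq ?enum_uniq // => x y; rewrite !mem_enum; exact: injf.
Qed.

(** The coefficient [c3] stays free because the two axes are rescaled independently. *)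
Definition on_cubic (R : comNzRingType) (b1 b0 c3 c2 c1 c0 x y : R) : Prop :=
  y ^+ 2 + (b1 * x + b0) * y = c3 * x ^+ 3 + c2 * x ^+ 2 + c1 * x + c0.

(** The translation vector is [(p, n - m)]; the pair [m], [n] encodes a vertical shift of either
    sign. *)
Lemma card_translate (R : realFieldType) (b1 b0 c3 c2 c1 c0 : R) (k : nat)
    (s : 'I_k -> nat) (p m n : nat) :
  c3 != 0 -> (forall i : 'I_k, on_cubic b1 b0 c3 c2 c1 c0 i%:R (s i)%:R) ->
  (0 < p)%N ->
  (#|[set e : 'I_k * 'I_k | (e.2 == e.1 + p :> nat)%N && (s e.2 + m == s e.1 + n)%N]|
   <= 4)%N.
Proof.
move=> c3n0 hs p0; set S := [set e | _].
pose P : R := p%:R; pose q : R := n%:R - m%:R; pose M := 2 * q + b1 * P.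
(* Subtracting the equations at (x, y) and (x + p, y + q) leaves
   M y = k2 x^2 + k1 x + k0; eliminating y gives a quartic in x, whose leading
   coefficient k2^2 does not vanish even if M does. *)
pose k2 := 3 * c3 * P.
pose k1 := 3 * c3 * P ^+ 2 + 2 * c2 * P - b1 * q.
pose k0 := c3 * P ^+ 3 + c2 * P ^+ 2 + c1 * P - q ^+ 2 - (b1 * P + b0) * q.
pose f := Poly [:: k0 ^+ 2 + M * b0 * k0 - M ^+ 2 * c0;
  2 * k0 * k1 + M * (b1 * k0 + b0 * k1) - M ^+ 2 * c1;
  k1 ^+ 2 + 2 * k0 * k2 + M * (b1 * k1 + b0 * k2) - M ^+ 2 * c2;
  2 * k1 * k2 + M * b1 * k2 - M ^+ 2 * c3; k2 ^+ 2].
have P0 : P != 0 by rewrite pnatr_eq0 -lt0n.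
have f0 : f != 0.
  apply/eqP => /(congr1 (fun g : {poly R} => g`_4)); rewrite coef_Poly coef0 /=.
  by apply/eqP; rewrite expf_neq0 // !mulf_neq0 // pnatr_eq0.
rewrite -ltnS; apply: leq_trans (size_Poly _ : (size f <= 5)%N).
apply: (card_lt_size_poly (f := fun e : 'I_k * 'I_k => e.1%:R : R)) => //.
  move=> [i j] [i' j']; rewrite !inE /= => /andP[/eqP hj _] /andP[/eqP hj' _] /eqP.
  rewrite eqr_nat => /eqP/val_inj eqi; subst i'; congr pair.
  by apply: val_inj; rewrite /= hj hj'.
move=> [i j]; rewrite inE /= => /andP[/eqP hj /eqP hsj].
have hi := hs i; have := hs j; rewrite /on_cubic in hi *.
have -> : j%:R = i%:R + P by rewrite hj natrD.
have -> : (s j)%:R = (s i)%:R + q :> R.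
  by rewrite /q addrA -natrD -hsj natrD addrK.
set x : R := i%:R in hi *; set y : R := (s i)%:R in hi *.
move=> hj2; rewrite rootE /f horner_Poly /=; apply/eqP.
have hM : M * y = k2 * x ^+ 2 + k1 * x + k0.
  by rewrite /M /k2 /k1 /k0; lra.
(* With [K = k2 x^2 + k1 x + k0], the root condition is [K^2 + M (b1 x + b0) K = M^2 (c3 x^3 + c2
   x^2 + c1 x + c0)]. It is [M^2] times the curve equation with [M y] replaced by [K]; the factor in
   [hM2] makes this replacement linear. *)
have hi2 := congr1 (fun z => M ^+ 2 * z) hi.
have hM2 := congr1 (fun z => (M * y + (k2 * x ^+ 2 + k1 * x + k0) + M * (b1 * x + b0)) * z) hM.
move: M k2 k1 k0 hi2 hM2 {hi hj2 hM f f0} => M k2 k1 k0 /= hi2 hM2; lra.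
Qed.

(** * Edges crossing a horizontal line *)

(* H is the equation of the curve restricted to the line y = h, and the sign of
   L tells on which side of the axis 2y + b1 x + b0 = 0 the point (x, h) lies. *)
Lemma ivt_level (R : rcfType) (b1 b0 c3 c2 c1 c0 x1 x2 y1 y2 h : R) :
  let L := Poly [:: 2 * h + b0; b1] in
  let H := Poly [:: h ^+ 2 + b0 * h - c0; b1 * h - c1; - c2; - c3] in
  x1 < x2 ->
  on_cubic b1 b0 c3 c2 c1 c0 x1 y1 -> on_cubic b1 b0 c3 c2 c1 c0 x2 y2 ->
  (0 <= 2 * y1 + b1 * x1 + b0) = (0 <= 2 * y2 + b1 * x2 + b0) ->
  (y1 < h < y2) || (y2 < h < y1) ->
  exists2 t, x1 < t < x2 & root (L * H) t.
Proof.
move=> L H lt_x on1 on2 eq_b lt_h.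
suff [/(poly_ivtoo (ltW lt_x))|/(poly_ivtoo (ltW lt_x))] :
    L.[x1] * L.[x2] < 0 \/ H.[x1] * H.[x2] < 0.
- by case=> t; rewrite in_itv /= => ht rt; exists t; rewrite // rootM rt.
- by case=> t; rewrite in_itv /= => ht rt; exists t; rewrite // rootM rt orbT.
pose l1 := 2 * h + b1 * x1 + b0; pose l2 := 2 * h + b1 * x2 + b0.
have L1 : L.[x1] = l1 by rewrite /L horner_Poly /= /l1; ring.
have L2 : L.[x2] = l2 by rewrite /L horner_Poly /= /l2; ring.
have H1 : H.[x1] = (h - y1) * (l1 - (h - y1)).
  by rewrite /H horner_Poly /= /l1; move: on1; rewrite /on_cubic; lra.
have H2 : H.[x2] = (h - y2) * (l2 - (h - y2)).
  by rewrite /H horner_Poly /= /l2; move: on2; rewrite /on_cubic; lra.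
rewrite {}L1 {}L2 {}H1 {}H2.
(* Here [ai = h - yi] and [ui = li], so [ui - 2 * ai] is the quantity whose sign defines the branch.
   If [u1] and [u2] do not have opposite signs, then [u1 - a1] and [u2 - a2] have the same sign, and
   [H] changes sign because [a1] and [a2] do. *)
have key (a1 a2 u1 u2 : R) : a2 < 0 -> 0 < a1 -> (0 <= u1 - 2 * a1) = (0 <= u2 - 2 * a2) ->
    u1 * u2 < 0 \/ a1 * (u1 - a1) * (a2 * (u2 - a2)) < 0.
  move=> a2n a1p; case: (lerP 0 (u1 - 2 * a1)) => s1 /esym s2.
    have [u2n|u2p] := ltP u2 0; [left; rewrite pmulr_rlt0; lra|right].
    by rewrite pmulr_rlt0 ?pmulr_rgt0 ?nmulr_rlt0 //; lra.
  have {}s2 : u2 - 2 * a2 < 0 by rewrite ltNge s2.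
  have [u1p|u1n] := ltP 0 u1; [left; rewrite pmulr_rlt0; lra|right].
  by rewrite nmulr_rlt0 ?nmulr_rgt0 ?pmulr_rlt0 //; lra.
have e1 : l1 - 2 * (h - y1) = 2 * y1 + b1 * x1 + b0 by rewrite /l1; ring.
have e2 : l2 - 2 * (h - y2) = 2 * y2 + b1 * x2 + b0 by rewrite /l2; ring.
case/orP: lt_h => /andP[h1 h2].
  by apply: key; rewrite ?e1 ?e2 //; lra.
by rewrite mulrC [X in _ \/ X < 0]mulrC; apply: key; rewrite ?e1 ?e2 //; lra.
Qed.

(* The line y = m + 1/2 separates the two endpoints of the edge e. *)
Definition crosses (k : nat) (s : 'I_k -> nat) (e : 'I_k * 'I_k) (m : nat) :=
  (s e.1 <= m < s e.2)%N || (s e.2 <= m < s e.1)%N.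

(** Each such edge has a root of [L * H] strictly above its interior; edges of one branch do not
    overlap, so these roots are distinct, and [L * H] has degree at most 4. *)
Lemma card_crosses_branch (R : rcfType) (b1 b0 c3 c2 c1 c0 : R) (k : nat)
    (s : 'I_k -> nat) (b : bool) (m : nat) :
  let u := fun i : 'I_k => 0 <= 2 * (s i)%:R + b1 * i%:R + b0 :> R in
  c3 != 0 -> (forall i : 'I_k, on_cubic b1 b0 c3 c2 c1 c0 i%:R (s i)%:R) ->
  (#|[set e in consecutive u | crosses s e m & u e.1 == b]| <= 4)%N.
Proof.
move=> u c3n0 hs; set S := [set e in _ | _ & _].
pose h : R := m%:R + 2^-1.
pose L := Poly [:: 2 * h + b0; b1].
pose H := Poly [:: h ^+ 2 + b0 * h - c0; b1 * h - c1; - c2; - c3].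
have H0 : H != 0.
  apply/eqP => /(congr1 (fun g : {poly R} => g`_3)); rewrite coef_Poly coef0 /=.
  by apply/eqP; rewrite oppr_eq0.
have lth (x y : nat) : (x <= m < y)%N -> ((x%:R : R) < h < y%:R).
  move=> /andP[xm my]; have : x%:R <= m%:R :> R by rewrite ler_nat.
  have : m%:R + 1 <= y%:R :> R by rewrite natr1 ler_nat.
  by rewrite /h; lra.
have SP e : e \in S -> exists2 t, e.1%:R < t < e.2%:R & root (L * H) t.
  rewrite inE => /andP[/consecutiveP[lt_e eq_u _] /andP[hc _]].
  apply: (@ivt_level R b1 b0 c3 c2 c1 c0 _ _ (s e.1)%:R (s e.2)%:R h) => //.
    by rewrite ltr_nat.
  by case/orP: hc => /lth ->; rewrite ?orbT.
(* If [L = 0], the axis separating the branches is the line [y = h] itself, and no edge within a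
   branch crosses it. *)
have [L0|L0] := eqVneq L 0.
  have b10 : b1 = 0 by have := congr1 (fun g : {poly R} => g`_1) L0; rewrite coef_Poly coef0.
  have b00 : 2 * h + b0 = 0.
    by have := congr1 (fun g : {poly R} => g`_0) L0; rewrite coef_Poly coef0.
  rewrite (_ : S = set0) ?cards0 //; apply/setP => e; rewrite in_set0.
  apply/negP; rewrite inE => /andP[/consecutiveP[_ eq_u _] /andP[hc _]].
  move: eq_u; rewrite /u b10 !mul0r !addr0.
  by case/orP: hc => /lth; lra.
have [t ht] : exists t : 'I_k * 'I_k -> R, forall e, e \in S ->
    e.1%:R < t e < e.2%:R /\ root (L * H) (t e).
  apply: (@fin_all_exists _ (fun=> R)
    (fun e t => e \in S -> e.1%:R < t < e.2%:R /\ root (L * H) t)) => e.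
  have [eS|] := boolP (e \in S); last by exists 0.
  by have [t] := SP e eS; exists t.
have sLH : (size (L * H)%R <= 5)%N.
  apply: leq_trans (size_polyMleq _ _) _.
  have := size_Poly [:: 2 * h + b0; b1]; rewrite -/L /= => sL.
  have := size_Poly [:: h ^+ 2 + b0 * h - c0; b1 * h - c1; - c2; - c3].
  rewrite -/H /= => sH.
  by lia.
rewrite -ltnS; apply: leq_trans sLH.
apply: (card_lt_size_poly (f := t)); first by rewrite mulf_neq0.
  move=> e f eS fS tef; have [/andP[e1 e2] _] := ht e eS.
  have [/andP[f1 f2] _] := ht f fS; rewrite -{}tef in f1 f2.
  move: eS fS; rewrite /S in_set => /andP[He /andP[_ /eqP ue]].
  rewrite in_set => /andP[Hf /andP[_ /eqP uf]].
  apply: (consecutive_overlap He Hf); first by rewrite ue uf.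
    by rewrite -(ltr_nat R); apply: lt_trans f2.
  by rewrite -(ltr_nat R); apply: lt_trans e2.
by move=> e /ht[].
Qed.

(** An edge of height at least [B] crosses at least [B] of the [k] levels [m + 1/2], and each level
    is crossed by at most 4 edges per branch. *)
Lemma card_tall_rows (R : rcfType) (b1 b0 c3 c2 c1 c0 : R) (k : nat)
    (s : 'I_k -> nat) (B : nat) :
  let u := fun i : 'I_k => 0 <= 2 * (s i)%:R + b1 * i%:R + b0 :> R in
  c3 != 0 -> (forall i : 'I_k, on_cubic b1 b0 c3 c2 c1 c0 i%:R (s i)%:R) ->
  (forall i, s i < k)%N ->
  (#|[set e in consecutive u | (s e.1 + B <= s e.2) || (s e.2 + B <= s e.1)]%N| * B
   <= k * 8)%N.
Proof.
move=> u c3n0 hs lt_s.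
apply: (double_count (cr := fun (e : 'I_k * 'I_k) (m : 'I_k) => crosses s e m)).
  move=> [i j]; rewrite inE /= => /andP[_ /orP[] le_s].
    apply: (@leq_trans (s j - s i)%N); first by lia.
    rewrite -(@card_ord_interval k) ?(ltnW (lt_s _)) //.
    by apply/subset_leq_card/subsetP => m; rewrite !inE /crosses => ->.
  apply: (@leq_trans (s i - s j)%N); first by lia.
  rewrite -(@card_ord_interval k) ?(ltnW (lt_s _)) //.
  by apply/subset_leq_card/subsetP => m; rewrite !inE /crosses => ->; rewrite orbT.
move=> m; apply: (@card_colour _ u _ 4) => b.
apply: leq_trans (card_crosses_branch b m c3n0 hs).
apply/subset_leq_card/subsetP => e; rewrite !inE.
by move=> /andP[/andP[/andP[-> _] ->] ->].
Qed.

(** * Short edges and the final count *)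

Lemma card_short (R : realFieldType) (b1 b0 c3 c2 c1 c0 : R) (k : nat)
    (s : 'I_k -> nat) (A B : nat) :
  c3 != 0 -> (forall i : 'I_k, on_cubic b1 b0 c3 c2 c1 c0 i%:R (s i)%:R) ->
  (#|[set e : 'I_k * 'I_k | [&& e.1 < e.2, e.2 - e.1 <= A,
       s e.2 <= s e.1 + B & s e.1 <= s e.2 + B]%N]| <= A * (2 * B).+1 * 4)%N.
Proof.
move=> c3n0 hs; set S := [set e | _].
pose T p n := [set e : 'I_k * 'I_k | (e.2 == e.1 + p :> nat)%N && (s e.2 + B == s e.1 + n)%N].
(* The index [v] stands for the difference vector [(v.1 + 1, v.2 - B)]. *)
have sub : S \subset \bigcup_(v : 'I_A * 'I_(2 * B).+1) T v.1.+1 v.2.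
  apply/subsetP => -[i j]; rewrite inE /= => /and4P[h1 h2 h3 h4].
  have ltA : ((j - i).-1 < A)%N by lia.
  have ltB : (s j + B - s i < (2 * B).+1)%N by lia.
  apply/bigcupP; exists (Ordinal ltA, Ordinal ltB) => //.
  by rewrite inE /=; apply/andP; split; apply/eqP; lia.
have leU : (#|\bigcup_(v : 'I_A * 'I_(2 * B).+1) T v.1.+1 v.2|
    <= \sum_(v : 'I_A * 'I_(2 * B).+1) #|T v.1.+1 v.2|)%N.
  elim/big_ind2: _ => [|m U n V le_U le_V|//]; first by rewrite cards0.
  by apply: leq_trans (leq_card_setU _ _) _; apply: leq_add.
apply: leq_trans (leq_trans (subset_leq_card sub) leU) _.
have leT (v : 'I_A * 'I_(2 * B).+1) : true -> (#|T v.1.+1 v.2| <= 4)%N.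
  by move=> _; apply: card_translate c3n0 hs _.
apply: leq_trans (leq_sum (index_enum _) leT) _.
by rewrite sum_nat_const card_prod !card_ord.
Qed.

Lemma cubic_bound (R : rcfType) (b1 b0 c3 c2 c1 c0 : R) (k : nat)
    (s : 'I_k -> nat) :
  c3 != 0 -> (forall i : 'I_k, on_cubic b1 b0 c3 c2 c1 c0 i%:R (s i)%:R) ->
  (forall i, s i < k)%N ->
  (k <= 4319)%N.
Proof.
move=> c3n0 hs lt_s.
pose u i := 0 <= 2 * (s i)%:R + b1 * i%:R + b0 :> R.
have hN := card_consecutive u.
have hP := card_long_columns u 6.
have hQ := card_tall_rows 24 c3n0 hs lt_s; rewrite -/u /= in hQ.
have hS := card_short 5 23 c3n0 hs.
set X := consecutive u in hN hP hQ.
set SP := [set e in X | _] in hP; set SQ := [set e in X | _] in hQ.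
set SS := [set e | _] in hS.
have sub : X \subset SP :|: (SQ :|: SS).
  apply/subsetP => -[i j] eX; have /consecutiveP[/= lt_ij _ _] := eX.
  have -> : (i, j) \in SP :|: (SQ :|: SS) = [|| 6 <= j - i,
      (s i + 24 <= s j) || (s j + 24 <= s i) |
      [&& i < j, j - i <= 5, s j <= s i + 23 & s i <= s j + 23]]%N.
    by rewrite 2!in_setU [_ \in SP]in_set [_ \in SQ]in_set [_ \in SS]in_set eX.
  lia.
have hX : (#|X| <= #|SP| + (#|SQ| + #|SS|))%N.
  apply: leq_trans (subset_leq_card sub) _.
  apply: leq_trans (leq_card_setU _ _) _; rewrite leq_add2l.
  exact: leq_card_setU.
(* The counts give [k - 2 <= k/3 + k/3 + 5 * 47 * 4], hence even [k <= 2826]. *)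
move: hX hN hP hQ hS; move: #|X| #|SP| #|SQ| #|SS| => nX nP nQ nS; lia.
Qed.

Theorem theorem3 (R : realType) (F : {pred R}) (hF : divring_closed F)
    (a b c d e : R)
    (ha : a \in F) (hb : b \in F) (hc : c \in F) (hd : d \in F) (he : e \in F)
    (hE : elliptic a b c d e)
    (k : nat) (P : 'I_k -> R * R)
    (hP : is_sap P)
    (hF_P : forall i, ((P i).1 \in F) /\ ((P i).2 \in F))
    (hE_P : forall i, on_curve a b c d e (P i)) :
  (k <= 4319)%N.
Proof.
have [inj_P [a1 [d1 [a2 [d2 [s PE]]]]]] := hP.
(* If [d1 = 0], all points lie on one vertical line, which meets the curve in at most 2 points. *)
have [d10|d1n0] := eqVneq d1 0.
  pose p := Poly [:: - (a1 ^+ 3 + c * a1 ^+ 2 + d * a1 + e); a * a1 + b; 1].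
  have p0 : p != 0.
    apply/eqP => /(congr1 (fun g : {poly R} => g`_2)); rewrite coef_Poly coef0 /=.
    by apply/eqP; rewrite oner_eq0.
  have : (#|[set: 'I_k]| < size p)%N.
    apply: (card_lt_size_poly (f := fun i => (P i).2)) => //.
      move=> i j _ _ eqP2; apply: inj_P; move: eqP2.
      by rewrite !PE d10 !mul0rn /= => ->.
    move=> i _; have := hE_P i; rewrite PE d10 mul0rn addr0 /= => Ei.
    by rewrite rootE horner_Poly /=; apply/eqP; lra.
  have := size_Poly [:: - (a1 ^+ 3 + c * a1 ^+ 2 + d * a1 + e); a * a1 + b; 1].
  by rewrite -/p cardsT card_ord /=; lia.
(* If d2 = 0 then all points have ordinate a2 + 1 * 0. *)
pose t (i : 'I_k) : nat := if d2 == 0 then 0%N else s i.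
pose D := if d2 == 0 then 1 else d2.
have D0 : D != 0 by rewrite /D; case: ifP => [_|/negbT //]; apply: oner_neq0.
have PE' i : P i = (a1 + d1 * i%:R, a2 + D * (t i)%:R).
  rewrite PE mulr_natr; congr pair; rewrite /D /t.
  by case: eqP => [->|_]; rewrite ?mul0rn ?mulr0 // mulr_natr.
(* The coefficients come from substituting [x = a1 + d1 * X], [y = a2 + D * Y] and dividing by
   [D ^+ 2]. *)
apply: (@cubic_bound R (a * d1 / D) ((2 * a2 + a * a1 + b) / D) (d1 ^+ 3 / D ^+ 2)
  ((3 * a1 * d1 ^+ 2 + c * d1 ^+ 2) / D ^+ 2)
  ((3 * a1 ^+ 2 * d1 + 2 * c * a1 * d1 + d * d1 - a * d1 * a2) / D ^+ 2)
  ((a1 ^+ 3 + c * a1 ^+ 2 + d * a1 + e - a2 ^+ 2 - a * a1 * a2 - b * a2) / D ^+ 2)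
  k t).
- by rewrite mulf_neq0 ?invr_eq0 ?expf_neq0.
- move=> i; have := hE_P i; rewrite PE' /on_curve /on_cubic.
  move/eqP; rewrite -subr_eq0 => /eqP Ei.
  apply/eqP; rewrite -subr_eq0; apply/eqP.
  by rewrite -[RHS](mul0r (D ^+ 2)^-1) -[in RHS]Ei; field.
- by move=> i; rewrite /t; case: eqP => _; [exact: leq_ltn_trans (ltn_ord i)|].
Qed.
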